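(* (1) Let $(X,d)$ be an unbounded ultrametric space, let $d^{*}\in(0,\infty)$, and let $\rho\colon X\times X\to\mathbb{R}^{+}$ be defined by $$\rho(x,y)=\frac{d^{*}\cdot d(x,y)}{1+d(x,y)}.$$ Then $(X,\rho)$ is a bounded ultrametric space and the distance set $(D(X,\rho),\leqslant)$ does not have the largest element. (2) Conversely, let $(X,\rho)$ be a nonempty ultrametric space such that $(D(X,\rho),\leqslant)$ does not have the largest element. Write $d^{*}=\operatorname{diam}(X,\rho)$. Then there is an unbounded ultrametric space $(X,d)$ such that $$\rho(x,y)=\frac{d^{*}\cdot d(x,y)}{1+d(x,y)}$$ holds for all $x,y\in X$.
   Context: $\mathbb{R}^{+}$ is the set of all nonnegative real numbers. An ultrametric on a set $X$ is a metric $d\colon X\times X\to\mathbb{R}^{+}$ satisfying $d(x,y)\le\max\{d(x,z),d(z,y)\}$ for all $x,y,z\in X$; an ultrametric space $(X,d)$ is a set $X$ with an ultrametric $d$ on it. For a metric space $(X,d)$, the distance set is $D(X,d)=\{d(x,y)\colon x,y\in X\}$, considered with the usual order $\leqslant$ of real numbers, and the diameter is $\operatorname{diam}(X,d)=\sup D(X,d)$. The space is bounded if $\operatorname{diam}(X,d)<\infty$ and unbounded otherwise.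
   Formalization: In part (2) the space (X,ρ) is additionally assumed bounded; otherwise d* = diam(X,ρ) is infinite and the formula fails, e.g. for ρ(m,n) = max(m,n), m ≠ n, on the natural numbers. *)

(* Defs.v *)
From HB Require Import structures.
From mathcomp Require Import all_boot all_order all_algebra.
From mathcomp Require Import classical_sets reals ereal.

Set Implicit Arguments.
Unset Strict Implicit.
Unset Printing Implicit Defensive.

Import Order.TTheory GRing.Theory Num.Theory.

Local Open Scope classical_set_scope.
Local Open Scope ring_scope.

(* Metrics are predicates on functions, rather than [metricType] instances,
   because several metrics on one and the same carrier are compared. *)
Record is_metric (R : realType) (X : Type) (d : X -> X -> R) : Prop := IsMetric {
  metric_ge0 : forall x y, 0 <= d x y;
  metric_eq0 : forall x y, d x y = 0 <-> x = y;
  metric_sym : forall x y, d x y = d y x;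
  metric_triangle : forall x y z, d x y <= d x z + d z y
}.

Record is_ultrametric (R : realType) (X : Type) (d : X -> X -> R) : Prop :=
  IsUltrametric {
  ultrametric_metric : is_metric d;
  ultrametric_max : forall x y z, d x y <= Num.max (d x z) (d z y)
}.

Definition distance_set (R : realType) (X : Type) (d : X -> X -> R) : set R :=
  [set r | exists x y, d x y = r].

(* Takes the value -oo, not 0, when X is empty; such an X is bounded either
   way. *)
Definition diam (R : realType) (X : Type) (d : X -> X -> R) : \bar R :=
  ereal_sup [set r%:E | r in distance_set d].

Definition is_bounded (R : realType) (X : Type) (d : X -> X -> R) : Prop :=
  (diam d < +oo)%E.

Definition has_largest (R : realType) (A : set R) : Prop :=
  exists2 m, A m & ubound A m.

(* Main.v *)
(**
On nonnegative reals the map [t |-> c * t / (1 + t)] is an order embedding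
into [[0, c[], with inverse [t |-> t / (c - t)], and being an ultrametric only
depends on the order of the distances. Under this embedding an unbounded
distance set corresponds to one that approaches [c] without attaining it; in
the converse direction, [c] is the diameter of [rho], which is not attained
because there is no largest distance.
*)
Require Import Defs.
From mathcomp Require Import all_boot all_order all_algebra.
From mathcomp Require Import classical_sets reals ereal.
From mathcomp Require Import ring lra.

Set Implicit Arguments.
Unset Strict Implicit.
Unset Printing Implicit Defensive.

Import Order.TTheory GRing.Theory Num.Theory.

Local Open Scope classical_set_scope.
Local Open Scope ring_scope.

(** After cross-multiplying by the positive denominators and dividing by [c], the term [r * s]
    occurs on both sides and cancels. *)
Lemma ler_mobius (R : realFieldType) (c r s : R) : 0 < c -> 0 <= r -> 0 <= s ->
  (c * r / (1 + r) <= c * s / (1 + s)) = (r <= s).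
Proof.
move=> c0 r0 s0.
rewrite ler_pdivrMr ?ltr_wpDr // mulrAC ler_pdivlMr ?ltr_wpDr //.
by rewrite -!mulrA ler_pM2l // !mulrDr !mulr1 (mulrC r s) lerD2r.
Qed.

Lemma mobius_lt (R : realFieldType) (c r : R) : 0 < c -> 0 <= r ->
  c * r / (1 + r) < c.
Proof.
move=> c0 r0; rewrite ltr_pdivrMr ?ltr_wpDr // ltr_pM2l //.
by rewrite ltrDr.
Qed.

Lemma mobius_ge0 (R : realFieldType) (c r : R) : 0 < c -> 0 <= r ->
  0 <= c * r / (1 + r).
Proof. by move=> c0 r0; rewrite divr_ge0 ?mulr_ge0 ?addr_ge0 // ltW. Qed.

Lemma mobiusK (R : realFieldType) (c t : R) : 0 <= t < c ->
  c * (t / (c - t)) / (1 + t / (c - t)) = t.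
Proof. by move=> /andP[t0 tc]; field; apply/andP; split; lra. Qed.

(** A monotone change of distances carries the max inequality over, and the triangle inequality
    follows since a max of nonnegative reals is at most their sum. Symmetry comes from monotonicity
    in both directions. *)
Lemma ultrametric_homo (R : realType) (X : Type) (d e : X -> X -> R) :
  is_ultrametric d -> (forall x y, 0 <= e x y) ->
  (forall x y, e x y = 0 <-> d x y = 0) ->
  (forall x y u v, d x y <= d u v -> e x y <= e u v) ->
  is_ultrametric e.
Proof.
move=> [[d0 deq dC _] dmax] e0 e_eq0 e_homo.
have emax x y z : e x y <= Num.max (e x z) (e z y).
  by have := dmax x y z; rewrite !le_max => /orP[] /e_homo ->; rewrite ?orbT.
split=> //; split=> //.
- by move=> x y; rewrite e_eq0.
- by move=> x y; apply/le_anti; rewrite !e_homo // dC.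
- move=> x y z; apply: le_trans (emax x y z) _.
  by rewrite ge_max lerDl lerDr !e0.
Qed.

Lemma is_boundedP (R : realType) (X : Type) (d : X -> X -> R) :
  is_bounded d <-> exists M, forall x y, d x y <= M.
Proof.
rewrite /is_bounded; split=> [|[M dM]].
  have ubd x y : ((d x y)%:E <= diam d)%E.
    by apply: ereal_sup_ubound; exists (d x y) => //; exists x, y.
  (* The value -oo arises only for empty [X], where any bound works. *)
  case: (diam d) ubd => // [M|] ubd _; last by exists 0 => x y; have := ubd x y.
  by exists M => x y; rewrite -lee_fin.
apply: (@le_lt_trans _ _ M%:E); last exact: ltry.
by apply: ge_ereal_sup => _ [_ [x [y <-]] <-]; rewrite lee_fin.
Qed.

Lemma diam_fin_num (R : realType) (X : Type) (d : X -> X -> R) :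
  inhabited X -> is_bounded d -> diam d \is a fin_num.
Proof.
move=> [x0] bd; rewrite fin_numElt bd andbT.
apply: (lt_le_trans (ltNyr (d x0 x0))).
by apply: ereal_sup_ubound; exists (d x0 x0) => //; exists x0, x0.
Qed.

Theorem theorem2p2 (R : realType) :
  (forall (X : Type) (d : X -> X -> R) (dstar : R) (rho : X -> X -> R),
     is_ultrametric d -> ~ is_bounded d -> 0 < dstar ->
     (forall x y, rho x y = dstar * d x y / (1 + d x y)) ->
     [/\ is_ultrametric rho, is_bounded rho
       & ~ has_largest (distance_set rho)])
  /\
  (forall (X : Type) (rho : X -> X -> R),
     inhabited X -> is_ultrametric rho -> is_bounded rho ->
     ~ has_largest (distance_set rho) ->
     let dstar := fine (diam rho) in
     exists d : X -> X -> R,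
       [/\ is_ultrametric d, ~ is_bounded d
         & forall x y, rho x y = dstar * d x y / (1 + d x y)]).
Proof.
split=> [X d c rho ud nbd c0 rhoE | X rho X0 urho brho nmax c].
  have d0 := metric_ge0 (ultrametric_metric ud).
  have rho_le x y u v : (rho x y <= rho u v) = (d x y <= d u v).
    by rewrite !rhoE ler_mobius.
  split.
  - apply: (ultrametric_homo ud) => [x y|x y|x y u v].
    + by rewrite rhoE mobius_ge0.
    + rewrite rhoE; split=> [/eqP|->]; last by rewrite mulr0 mul0r.
      (* Since [0^-1 = 0], the quotient would also vanish with its denominator; this rules that case
         out. *)
      have d1 : 1 + d x y != 0 by rewrite gt_eqF // ltr_wpDr.
      by rewrite !mulf_eq0 invr_eq0 (negbTE d1) orbF gt_eqF //= => /eqP.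
    + by rewrite rho_le.
  - by apply/is_boundedP; exists c => x y; rewrite rhoE ltW // mobius_lt.
  (* A pair maximizing [rho] also maximizes [d], which would bound [d]. *)
  - move=> [_ [x [y <-]] ubxy]; apply/nbd/is_boundedP; exists (d x y) => u v.
    by rewrite -rho_le; apply: ubxy; exists u, v.
have cE : diam rho = c%:E by rewrite fineK // diam_fin_num.
have rho0 := metric_ge0 (ultrametric_metric urho).
have rho_lec x y : rho x y <= c.
  by rewrite -lee_fin -cE; apply: ereal_sup_ubound; exists (rho x y) => //; exists x, y.
have rho_ltc x y : rho x y < c.
  (* If the supremum [c] were attained, it would be a largest distance. *)
  rewrite lt_neqAle rho_lec andbT; apply/eqP => xyc; apply: nmax.
  by exists c => [|_ [u [v <-]]]; [exists x, y|].
have [x0] := X0.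
have c0 : 0 < c := le_lt_trans (rho0 x0 x0) (rho_ltc x0 x0).
pose d x y := rho x y / (c - rho x y).
have d0 x y : 0 <= d x y by rewrite divr_ge0 // subr_ge0.
have rhoE x y : rho x y = c * d x y / (1 + d x y).
  by rewrite mobiusK // rho0 rho_ltc.
exists d; split=> //.
- apply: (ultrametric_homo urho) => // [x y|x y u v].
  + split=> [dxy|rxy]; first by rewrite rhoE dxy mulr0 mul0r.
    by rewrite /d rxy mul0r.
  + by rewrite !rhoE ler_mobius.
- move=> /is_boundedP[M dM].
  have M0 : 0 <= M := le_trans (d0 x0 x0) (dM x0 x0).
  (* A bound [M] on [d] makes [c * M / (1 + M)] an upper bound of [rho] strictly below its supremum
     [c]. *)
  have := mobius_lt c0 M0; apply/negP; rewrite -leNgt -lee_fin -cE.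
  by apply: ge_ereal_sup => _ [_ [x [y <-]] <-]; rewrite lee_fin rhoE ler_mobius.
Qed.
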